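(* Let $K$ be a group, let $(PQR): P\xrightarrow{\bar\jmath}Q\xrightarrow{\bar\phi}R$ be a group extension, let $\theta:Q\to\mathrm{Out}(K)$ be an outer action, let $(KNP): K\xrightarrow{i_0}N\xrightarrow{\pi_0}P$ be an extension with outer action $\theta|_P$ and mod-$K$ outer action $\Theta_P:P\to\mathrm{Out}(N;K)$, and let $\Theta:Q\to\mathrm{Out}(N;K)$ be a $(\theta,\complement_P^Q)$-prolongation of $\Theta_P$. Then the bijection $$-\diamond\Theta:\ Z^1(R,H^1(P,Z(K)))\xrightarrow{\ \simeq\ }\{(\theta,\complement_P^Q)\text{-prolongations of }\Theta_P\},\qquad \Gamma\mapsto\bigl(q\mapsto\Gamma(\bar\phi(q))\cdot\Theta(q)\bigr),$$ induces a bijection $$-\diamond\Theta:\ H^1(R,H^1(P,Z(K)))\xrightarrow{\ \simeq\ }\left\{\begin{array}{l}\mathrm{Aut}(KNP)\text{-conjugacy classes of}\\(\theta,\complement_P^Q)\text{-prolongations of }\Theta_P\end{array}\right\}.$$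
   Context: Conventions. For a group $H$ and an $H$-module $A$ (multiplicative), cochains are normalized (trivial value at the identity); $Z^1(H,A)$ is the group of maps $\lambda$ with $\lambda(h_1h_2)=\lambda(h_1)\cdot{}^{h_1}\lambda(h_2)$, $B^1(H,A)=\{\partial a: h\mapsto a^{-1}\cdot{}^{h}a\}$, $H^1=Z^1/B^1$. Extensions. An extension of $K$ by $P$ is $(N,i_0,\pi_0)$ with $i_0:K\to N$ injective, $\pi_0:N\to P$ surjective homomorphisms, $i_0(K)=\mathrm{Ker}(\pi_0)$; groups are identified with their images under the given injections. Conjugation induces the outer action $P\to\mathrm{Out}(K)=\mathrm{Aut}(K)/\mathrm{Inn}(K)$ of the extension. $Q$ acts on $Z(K)$ via $\theta$; $\theta|_P:=\theta\circ\bar\jmath$. $R$ acts on $H^1(P,Z(K))$ by ${}^r[\lambda]=[{}^q\lambda]$ for any $q\in Q$ with $\bar\phi(q)=r$, where ${}^q\lambda(p)={}^{\theta(q)}\lambda(q^{-1}pq)$. Mod-$K$ outer actions. $\mathrm{Aut}_K(N)$ is the group of automorphisms $\eta$ of $N$ with $\eta(K)=K$; $\mathrm{Out}(N;K):=\mathrm{Aut}_K(N)/\complement_N(K)$, with $\complement_N(K)$ the inner automorphisms of $N$ by elements of $K$. There are canonical homomorphisms $\mathrm{Out}(N;K)\to\mathrm{Out}(K)$ and $\mathrm{Out}(N;K)\to\mathrm{Aut}(P)$. $\Theta_P:P\to\mathrm{Out}(N;K)$ is induced by conjugation of $N$ on itself. A $(\theta,\complement_P^Q)$-prolongation of $\Theta_P$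 is a homomorphism $\Theta:Q\to\mathrm{Out}(N;K)$ with $\Theta\circ\bar\jmath=\Theta_P$ whose composites with these canonical homomorphisms are $\theta$ and the conjugation action $\complement_P^Q:Q\to\mathrm{Aut}(P)$ respectively. $\mathrm{Aut}(KNP):=\{\eta\in\mathrm{Aut}(N):\eta\circ i_0=i_0,\ \pi_0\circ\eta=\pi_0\}$ and $\mathrm{Out}(KNP;K)$ is its image in $\mathrm{Out}(N;K)$. The group $H^1(P,Z(K))$ is identified with the subgroup $\mathrm{Out}(KNP;K)$ of $\mathrm{Out}(N;K)$ via the isomorphism sending $[\lambda]$ to the class of the automorphism $n\mapsto\lambda(\pi_0(n))\cdot n$. Two homomorphisms $\Theta_1,\Theta_2:Q\to\mathrm{Out}(N;K)$ are $\mathrm{Aut}(KNP)$-conjugate iff there is $\eta\in\mathrm{Aut}(KNP)$, with image $\bar\eta\in\mathrm{Out}(KNP;K)$, such that $\Theta_2(q)=\bar\eta^{-1}\cdot\Theta_1(q)\cdot\bar\eta$ for all $q\in Q$. *)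

(* Defs.v *)
From HB Require Import structures.
From mathcomp Require Import all_boot.
From mathcomp Require Import boolp classical_sets functions.

Set Implicit Arguments.
Unset Strict Implicit.
Unset Printing Implicit Defensive.

Local Open Scope quotient_scope.
Local Open Scope classical_set_scope.
Local Open Scope group_scope.

(* Groups are arbitrary (possibly infinite) groupTypes. Their choiceType
   structure costs no generality: every type carries one classically, and
   this is how the function-like types below receive theirs. *)

Notation "{ 'hom' G -> H }" := (UMagmaMorphism.type G%type H%type)
  (at level 0, G at level 98, H at level 99,
   format "{ 'hom'  G  ->  H }") : type_scope.

HB.mixin Record isConjClosed (G : groupType) (S : {pred G}) := {
  conj_closed : forall x y : G, y \in S -> x * y * x^-1 \in S
}.

#[short(type="normalClosed")]
HB.structure Definition NormalClosed (G : groupType) :=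
  {S of isConjClosed G S & GroupClosed G S}.

Lemma groupHomP (G H : groupType) (f : G -> H) :
  {morph f : x y / x * y} -> monoid_morphism f.
Proof.
move=> fM; split=> //; apply: (mulIg (f 1)).
by rewrite -fM !mul1g.
Qed.

Section Quotient.
Variables (G : groupType) (S : normalClosed G).

(* x ~ y iff x S = y S; since S is normal, left and right cosets agree. *)
Definition quot_rel : rel G := fun x y => x^-1 * y \in S.

Lemma quot_rel_refl : reflexive quot_rel.
Proof. by move=> x; rewrite /quot_rel mulVg gpred1. Qed.

Lemma quot_rel_sym : symmetric quot_rel.
Proof.
have h x y : quot_rel x y -> quot_rel y x.
  by rewrite /quot_rel => /gpredVr; rewrite invgM invgK.
by move=> x y; apply/idP/idP; apply: h.
Qed.

Lemma quot_rel_trans : transitive quot_rel.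
Proof.
move=> y x z hxy hyz; have := gpredM _ _ hxy hyz.
by rewrite /quot_rel -mulgA mulVKg.
Qed.

Canonical quot_equiv := EquivRel quot_rel quot_rel_refl quot_rel_sym quot_rel_trans.

Definition quot := {eq_quot quot_equiv}.
HB.instance Definition _ := Choice.on quot.
HB.instance Definition _ := EqQuotient.on quot.

Lemma quot_eqP (x y : G) : (\pi_quot x = \pi_quot y) <-> x^-1 * y \in S.
Proof. by split=> [/eqmodP|h]; last apply/eqmodP. Qed.

Definition quot_mul (a b : quot) : quot := \pi_quot (repr a * repr b).
Definition quot_one : quot := \pi_quot 1.
Definition quot_inv (a : quot) : quot := \pi_quot (repr a)^-1.

Lemma repr_piP (x : G) : exists2 s, s \in S & repr (\pi_quot x) = x * s.
Proof.
exists (x^-1 * repr (\pi_quot x)); last by rewrite mulVKg.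
by apply/quot_eqP; rewrite reprK.
Qed.

Lemma quot_piM (x y : G) : \pi_quot (x * y) = quot_mul (\pi_quot x) (\pi_quot y).
Proof.
rewrite /quot_mul; have [s sS ->] := repr_piP x; have [t tS ->] := repr_piP y.
apply/quot_eqP; rewrite invgM !mulgA mulgVK gpredM//.
by have /= := @conj_closed _ S y^-1 s sS; rewrite invgK.
Qed.

Lemma quot_mulA : associative quot_mul.
Proof.
move=> a b c; rewrite -(reprK a) -(reprK b) -(reprK c).
by rewrite -(quot_piM (repr b)) -(quot_piM (repr a) (repr b)) -!quot_piM mulgA.
Qed.
Lemma quot_mul1 : left_id quot_one quot_mul.
Proof. by move=> a; rewrite -(reprK a) -quot_piM mul1g. Qed.
Lemma quot_1mul : right_id quot_one quot_mul.
Proof. by move=> a; rewrite -(reprK a) -quot_piM mulg1. Qed.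
Lemma quot_mulV : left_inverse quot_one quot_inv quot_mul.
Proof.
by move=> a; rewrite -[X in quot_mul _ X](reprK a) -quot_piM mulVg.
Qed.
Lemma quot_Vmul : right_inverse quot_one quot_inv quot_mul.
Proof.
by move=> a; rewrite -[X in quot_mul X _](reprK a) -quot_piM mulgV.
Qed.

HB.instance Definition _ := isGroup.Build quot
  quot_mulA quot_mul1 quot_1mul quot_mulV quot_Vmul.

Definition qpi (x : G) : quot := \pi_quot x.
HB.instance Definition _ := isUMagmaMorphism.Build G quot qpi
  (groupHomP (quot_piM : {morph qpi : x y / x * y})).

Lemma qpi_surj (c : quot) : exists x, qpi x = c.
Proof. by exists (repr c); rewrite /qpi reprK. Qed.

Lemma qpi_eqP (x y : G) : qpi x = qpi y <-> x^-1 * y \in S.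
Proof. exact: quot_eqP. Qed.

Lemma qpi1P (x : G) : qpi x = 1 <-> x \in S.
Proof.
have <- : qpi 1 = 1 by [].
by split=> [/esym/qpi_eqP|h]; [|apply/esym/qpi_eqP]; rewrite invg1 mul1g.
Qed.

Section Lift.
Variables (H : groupType) (f : {hom G -> H}).
Hypothesis fS : forall x, x \in S -> f x = 1.

Definition quot_lift of (forall x, x \in S -> f x = 1) :=
  fun c : quot => f (repr c).

Lemma quot_liftE x : quot_lift fS (qpi x) = f x.
Proof.
by rewrite /quot_lift /qpi; have [s sS ->] := repr_piP x; rewrite gmulfM (fS sS) mulg1.
Qed.

Lemma quot_liftM : {morph quot_lift fS : x y / x * y}.
Proof.
move=> a b; have [x <-] := qpi_surj a; have [y <-] := qpi_surj b.
by rewrite -gmulfM !quot_liftE gmulfM.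
Qed.

HB.instance Definition _ := isUMagmaMorphism.Build quot H (quot_lift fS)
  (groupHomP quot_liftM).
End Lift.
End Quotient.

Section Aut.
Variable G : groupType.

Record Aut := MkAut {
  aut_fun :> G -> G;
  aut_morph : {morph aut_fun : x y / x * y};
  aut_bij : bijective aut_fun }.

HB.instance Definition _ := gen_eqMixin Aut.
HB.instance Definition _ := gen_choiceMixin Aut.
HB.instance Definition _ (f : Aut) := isUMagmaMorphism.Build G G (aut_fun f)
  (groupHomP (@aut_morph f)).

Lemma aut_ext (f g : Aut) : f =1 g -> f = g.
Proof.
case: f g => [f fM fb] [g gM gb] /= /funext fg; subst g.
by congr MkAut; apply: Prop_irrelevance.
Qed.

Lemma aut_inv_ex (f : Aut) : exists g : G -> G, cancel f g /\ cancel g f.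
Proof. by have [g] := aut_bij f; exists g. Qed.

Definition aut_invfun (f : Aut) : G -> G := sval (cid (aut_inv_ex f)).
Lemma aut_invK (f : Aut) : cancel f (aut_invfun f).
Proof. by rewrite /aut_invfun; case: cid => ? []. Qed.
Lemma aut_Kinv (f : Aut) : cancel (aut_invfun f) f.
Proof. by rewrite /aut_invfun; case: cid => ? []. Qed.

Definition aut_one : Aut := MkAut (fun x y => erefl) (Bijective (g := id) (fun x => erefl) (fun x => erefl)).
(* Composition order: (f * g) x = f (g x), so groups act on the left. *)
Definition aut_mul (f g : Aut) : Aut :=
  MkAut (comp_gmulfM f g) (bij_comp (aut_bij f) (aut_bij g)).
Definition aut_inv (f : Aut) : Aut :=
  MkAut (can2_gmulfM (@aut_invK f) (@aut_Kinv f)) (Bijective (@aut_Kinv f) (@aut_invK f)).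

Lemma aut_mulA : associative aut_mul.
Proof. by move=> f g h; apply: aut_ext. Qed.
Lemma aut_mul1 : left_id aut_one aut_mul.
Proof. by move=> f; apply: aut_ext. Qed.
Lemma aut_1mul : right_id aut_one aut_mul.
Proof. by move=> f; apply: aut_ext. Qed.
Lemma aut_mulV : left_inverse aut_one aut_inv aut_mul.
Proof. by move=> f; apply: aut_ext => x /=; rewrite aut_invK. Qed.
Lemma aut_Vmul : right_inverse aut_one aut_inv aut_mul.
Proof. by move=> f; apply: aut_ext => x /=; rewrite aut_Kinv. Qed.

HB.instance Definition _ := isGroup.Build Aut
  aut_mulA aut_mul1 aut_1mul aut_mulV aut_Vmul.

Lemma autM (f g : Aut) x : (f * g) x = f (g x). Proof. by []. Qed.
Lemma aut1 x : (1 : Aut) x = x. Proof. by []. Qed.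
Lemma aut_mulr (f : Aut) x y : f (x * y) = f x * f y.
Proof. exact: gmulfM. Qed.
Lemma aut_invr (f : Aut) x : f x^-1 = (f x)^-1. Proof. exact: gmulfV. Qed.
Lemma aut_1r (f : Aut) : f 1 = 1. Proof. exact: gmulf1. Qed.
Lemma autK (f : Aut) : cancel f (f^-1)%g. Proof. exact: aut_invK. Qed.
Lemma autVK (f : Aut) : cancel (f^-1)%g f. Proof. exact: aut_Kinv. Qed.
End Aut.

Section Inner.
Variable G : groupType.

Lemma inner_morph (x : G) : {morph (fun n => x * n * x^-1) : m n / m * n}.
Proof. by move=> m n; rewrite !mulgA mulgVK. Qed.

Lemma inner_bij (x : G) : bijective (fun n => x * n * x^-1).
Proof.
by exists (fun n => x^-1 * n * x) => n; rewrite !mulgA ?mulVg ?mulgV ?mul1g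
  ?mulgVK ?mulgK.
Qed.

Definition inner (x : G) : Aut G := MkAut (inner_morph x) (inner_bij x).

Lemma innerM : {morph inner : x y / x * y}.
Proof. by move=> x y; apply: aut_ext => n /=; rewrite invgM !mulgA. Qed.

HB.instance Definition _ := isUMagmaMorphism.Build G (Aut G) inner
  (groupHomP innerM).

Lemma aut_inner (f : Aut G) (x : G) : f * inner x * f^-1 = inner (f x).
Proof.
apply: aut_ext => n; rewrite !autM /=.
by rewrite !gmulfM gmulfV /= aut_Kinv.
Qed.

Definition Inn : {pred Aut G} := fun f => `[< exists x, f = inner x >].

Lemma innP f : reflect (exists x, f = inner x) (f \in Inn).
Proof. exact: asboolP. Qed.

Lemma Inn1 : 1 \in Inn.
Proof. by apply/innP; exists 1; rewrite gmulf1. Qed.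
Lemma InnM : mulg_closed Inn.
Proof.
move=> f g /innP[x ->] /innP[y ->]; apply/innP; exists (x * y).
by rewrite gmulfM.
Qed.
Lemma InnV : invg_closed Inn.
Proof. by move=> f /innP[x ->]; apply/innP; exists x^-1; rewrite gmulfV. Qed.
Lemma InnJ (g f : Aut G) : f \in Inn -> g * f * g^-1 \in Inn.
Proof. by move=> /innP[y ->]; apply/innP; exists (g y); rewrite aut_inner. Qed.

HB.instance Definition _ := isMulClosed.Build (Aut G) Inn InnM.
HB.instance Definition _ := isMul1Closed.Build (Aut G) Inn Inn1.
HB.instance Definition _ := isInvClosed.Build (Aut G) Inn InnV.
HB.instance Definition _ := isConjClosed.Build (Aut G) Inn (fun g f => @InnJ g f).

Definition Out := quot Inn.
HB.instance Definition _ := Group.on Out.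

Definition ctr : {pred G} := fun z => `[< forall x, z * x = x * z >].

Lemma ctrP z : reflect (forall x, z * x = x * z) (z \in ctr).
Proof. exact: asboolP. Qed.

Lemma ctr_closed : group_closed ctr.
Proof.
split=> [|y z /ctrP hy /ctrP hz]; apply/ctrP => x; first by rewrite mul1g mulg1.
have hz' : z^-1 * x = x * z^-1.
  by apply: (mulgI z); rewrite mulVKg mulgA hz mulgK.
by rewrite -mulgA hz' mulgA hy mulgA.
Qed.

Definition center := {z : G | z \in ctr}.
HB.instance Definition _ := Choice.on center.
HB.instance Definition _ := SubChoice.on center.
HB.instance Definition _ := SubChoice_isSubGroup.Build G ctr center ctr_closed.

Lemma centerC (z w : center) : z * w = w * z.
Proof. by apply: val_inj => /=; have /ctrP := valP z; apply. Qed.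

Lemma center_mem (f : Aut G) (z : center) : f (val z) \in ctr.
Proof.
apply/ctrP => x; rewrite -(autVK f x) -!gmulfM.
by have /ctrP -> := valP z.
Qed.

Definition res_center (f : Aut G) (z : center) : center :=
  exist _ (f (val z)) (center_mem f z).

Lemma res_center_morph f : {morph res_center f : z w / z * w}.
Proof. by move=> z w; apply: val_inj; rewrite /= gmulfM. Qed.

Lemma res_center_bij f : bijective (res_center f).
Proof.
by exists (res_center f^-1) => z; apply: val_inj => /=; rewrite ?aut_invK ?aut_Kinv.
Qed.

Definition aut_center (f : Aut G) : Aut center :=
  MkAut (res_center_morph f) (res_center_bij f).

Lemma aut_centerM : {morph aut_center : f g / f * g}.
Proof. by move=> f g; apply: aut_ext => z; apply: val_inj. Qed.

HB.instance Definition _ := isUMagmaMorphism.Build (Aut G) (Aut center)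
  aut_center (groupHomP aut_centerM).

Lemma aut_center_Inn f : f \in Inn -> aut_center f = 1.
Proof.
move=> /innP[x ->]; apply: aut_ext => z; apply: val_inj => /=.
by have /ctrP/(_ x) <- := valP z; rewrite mulgK.
Qed.

Definition out_center : {hom Out -> Aut center} :=
  quot_lift aut_center_Inn.

End Inner.

Section Modules.

(* A module is an abelian group, written multiplicatively, with a left action
   by automorphisms. *)
Record gmodule (H : groupType) := GModule {
  gm_group :> groupType;
  gm_comm : forall a b : gm_group, a * b = b * a;
  gm_act : {hom H -> Aut gm_group} }.

Variables (H : groupType) (A : gmodule H).

Local Notation "h ∙ a" := (gm_act A h a) (at level 39).

Lemma actM h k a : (h * k) ∙ a = h ∙ (k ∙ a).
Proof. by rewrite gmulfM. Qed.
Lemma act1 a : 1 ∙ a = a.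
Proof. by rewrite gmulf1. Qed.

Record Z1 := MkZ1 {
  z1_fun :> H -> A;
  z1_norm : z1_fun 1 = 1;
  z1_cocycle : forall h1 h2, z1_fun (h1 * h2) = z1_fun h1 * h1 ∙ z1_fun h2 }.

HB.instance Definition _ := gen_eqMixin Z1.
HB.instance Definition _ := gen_choiceMixin Z1.

Lemma z1_ext (f g : Z1) : f =1 g -> f = g.
Proof.
case: f g => [f fM fb] [g gM gb] /= /funext fg; subst g.
by congr MkZ1; apply: Prop_irrelevance.
Qed.

Lemma z1_one_cocycle (h1 h2 : H) : 1 = 1 * h1 ∙ 1 :> A.
Proof. by rewrite gmulf1 mulg1. Qed.
Definition z1_one : Z1 := @MkZ1 (fun=> 1) erefl (z1_one_cocycle).

Lemma z1_mul_norm (f g : Z1) : f 1 * g 1 = 1.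
Proof. by rewrite !z1_norm mulg1. Qed.
Lemma z1_mul_cocycle (f g : Z1) h1 h2 :
  f (h1 * h2) * g (h1 * h2) = (f h1 * g h1) * h1 ∙ (f h2 * g h2).
Proof.
rewrite !z1_cocycle gmulfM !mulgA; congr (_ * _).
by rewrite -!mulgA; congr (_ * _); rewrite gm_comm.
Qed.
Definition z1_mul (f g : Z1) : Z1 :=
  @MkZ1 (fun h => f h * g h) (z1_mul_norm f g) (z1_mul_cocycle f g).

Lemma z1_inv_norm (f : Z1) : (f 1)^-1 = 1.
Proof. by rewrite z1_norm invg1. Qed.
Lemma z1_inv_cocycle (f : Z1) h1 h2 :
  (f (h1 * h2))^-1 = (f h1)^-1 * h1 ∙ (f h2)^-1.
Proof. by rewrite z1_cocycle gmulfV invgM gm_comm. Qed.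
Definition z1_inv (f : Z1) : Z1 :=
  @MkZ1 (fun h => (f h)^-1) (z1_inv_norm f) (z1_inv_cocycle f).

Lemma z1_mulA : associative z1_mul.
Proof. by move=> f g k; apply: z1_ext => h /=; rewrite mulgA. Qed.
Lemma z1_mul1 : left_id z1_one z1_mul.
Proof. by move=> f; apply: z1_ext => h /=; rewrite mul1g. Qed.
Lemma z1_1mul : right_id z1_one z1_mul.
Proof. by move=> f; apply: z1_ext => h /=; rewrite mulg1. Qed.
Lemma z1_mulV : left_inverse z1_one z1_inv z1_mul.
Proof. by move=> f; apply: z1_ext => h /=; rewrite mulVg. Qed.
Lemma z1_Vmul : right_inverse z1_one z1_inv z1_mul.
Proof. by move=> f; apply: z1_ext => h /=; rewrite mulgV. Qed.

HB.instance Definition _ := isGroup.Build Z1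
  z1_mulA z1_mul1 z1_1mul z1_mulV z1_Vmul.

Lemma z1C (f g : Z1) : f * g = g * f.
Proof. by apply: z1_ext => h /=; apply: gm_comm. Qed.

Definition B1 : {pred Z1} :=
  fun f => `[< exists a : A, forall h, f h = a^-1 * h ∙ a >].

Lemma b1P (f : Z1) : reflect (exists a : A, forall h, f h = a^-1 * h ∙ a) (f \in B1).
Proof. exact: asboolP. Qed.

Lemma B11 : 1 \in B1.
Proof. by apply/b1P; exists 1 => h; rewrite gmulf1 mulVg. Qed.
Lemma B1M : mulg_closed B1.
Proof.
move=> f g /b1P[a fa] /b1P[b gb]; apply/b1P; exists (b * a) => h /=.
rewrite fa gb gmulfM invgM -!mulgA; congr (_ * _).
by rewrite [LHS]gm_comm -mulgA.
Qed.
Lemma B1V : invg_closed B1.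
Proof.
move=> f /b1P[a fa]; apply/b1P; exists a^-1 => h /=.
by rewrite fa invgM invgK gmulfV gm_comm.
Qed.
Lemma B1J (g f : Z1) : f \in B1 -> g * f * g^-1 \in B1.
Proof. by rewrite z1C mulgA mulVg mul1g. Qed.

HB.instance Definition _ := isMulClosed.Build Z1 B1 B1M.
HB.instance Definition _ := isMul1Closed.Build Z1 B1 B11.
HB.instance Definition _ := isInvClosed.Build Z1 B1 B1V.
HB.instance Definition _ := isConjClosed.Build Z1 B1 (fun g f => @B1J g f).

Definition H1 := quot B1.
HB.instance Definition _ := Group.on H1.

Lemma h1C (x y : H1) : x * y = y * x.
Proof.
by have [f <-] := qpi_surj x; have [g <-] := qpi_surj y; rewrite -!gmulfM z1C.
Qed.
End Modules.

Section Extensions.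

Record extension (K N P : groupType) := Extension {
  ext_inj : {hom K -> N};
  ext_proj : {hom N -> P};
  ext_inj_injective : injective ext_inj;
  ext_proj_surjective : forall p, exists n, ext_proj n = p;
  ext_exact : range ext_inj = [set n | ext_proj n = 1] }.

Variables (K N P : groupType) (E : extension K N P).
Local Notation i := (ext_inj E).
Local Notation π := (ext_proj E).

Lemma ext_kerP n : π n = 1 <-> exists k, i k = n.
Proof.
have h := ext_exact E; split=> [nE|[k <-]].
  have : range i n by rewrite h.
  by case=> k _ <-; exists k.
have : range i (i k) by exists k.
by rewrite h.
Qed.

Lemma ext_proj_inj k : π (i k) = 1.
Proof. by apply/ext_kerP; exists k. Qed.

Lemma ext_proj_eq m n : π m = π n -> exists k, n = m * i k.
Proof.
move=> mn; have /ext_kerP[k kE] : π (m^-1 * n) = 1.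
  by rewrite gmulfM gmulfV mn mulVg.
by exists k; rewrite kE mulVKg.
Qed.

(* A section of π as a mere function, obtained by choice. It only evaluates
   functions of n : N that depend on π n alone; see ext_descE, proj_funE. *)
Definition ext_sect (p : P) : N := sval (cid (ext_proj_surjective E p)).

Lemma ext_sectK : cancel ext_sect π.
Proof. by move=> p; rewrite /ext_sect; case: cid. Qed.

Section Descent.
Variables (H : groupType) (f : {hom N -> H}).
Hypothesis fK : forall k, f (i k) = 1.

(* The homomorphism P -> H through which f factors. *)
Definition ext_desc of (forall k, f (i k) = 1) := fun p : P => f (ext_sect p).

Lemma ext_descE n : ext_desc fK (π n) = f n.
Proof.
rewrite /ext_desc; have [k kE] := ext_proj_eq (ext_sectK (π n)).
by rewrite [in RHS]kE gmulfM /= fK mulg1.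
Qed.

Lemma ext_descM : {morph ext_desc fK : x y / x * y}.
Proof.
move=> p q; rewrite -{1}(ext_sectK p) -{1}(ext_sectK q) -gmulfM ext_descE.
by rewrite gmulfM.
Qed.

HB.instance Definition _ := isUMagmaMorphism.Build P H (ext_desc fK)
  (groupHomP ext_descM).
End Descent.

(* AutK, InnK and OutNK are Aut_K(N), the inner automorphisms of N by elements
   of K, and Out(N;K) = Aut_K(N) / InnK. *)
Definition stabK : {pred Aut N} := fun η => `[< η @` range i = range i >].

Lemma stabKP (η : Aut N) : reflect (η @` range i = range i) (η \in stabK).
Proof. exact: asboolP. Qed.

Lemma stabK_closed : group_closed stabK.
Proof.
split=> [|f g /stabKP fE /stabKP gE]; apply/stabKP.
  by rewrite image_id.
move: (range i) fE gE => A fE gE.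
have gVE : (g^-1)%g @` A = A.
  rewrite -{1}gE image_comp; apply/seteqP; split=> [n [m mA <-]|n nA] /=.
    by rewrite aut_invK.
  by exists n => //=; rewrite aut_invK.
by rewrite -[RHS]fE -[in RHS]gVE image_comp.
Qed.

Definition AutK := {η : Aut N | η \in stabK}.
HB.instance Definition _ := Choice.on AutK.
HB.instance Definition _ := SubChoice.on AutK.
HB.instance Definition _ :=
  SubChoice_isSubGroup.Build (Aut N) stabK AutK stabK_closed.

Lemma res_ex (η : AutK) k : exists k', i k' = val η (i k).
Proof.
have /stabKP h := valP η.
have : range i (val η (i k)) by rewrite -h; exists (i k) => //; exists k.
by case=> k' _ <-; exists k'.
Qed.

Definition res_fun (η : AutK) (k : K) : K := sval (cid (res_ex η k)).

Lemma res_funE η k : i (res_fun η k) = val η (i k).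
Proof. by rewrite /res_fun; case: cid. Qed.

Lemma res_fun_morph η : {morph res_fun η : x y / x * y}.
Proof.
move=> x y; apply: (@ext_inj_injective _ _ _ E).
by rewrite gmulfM !res_funE !gmulfM.
Qed.

Lemma res_fun_bij η : bijective (res_fun η).
Proof.
exists (res_fun (η^-1)%g) => k; apply: (@ext_inj_injective _ _ _ E);
  by rewrite !res_funE /= ?aut_invK ?aut_Kinv.
Qed.

Definition resK (η : AutK) : Aut K := MkAut (res_fun_morph η) (res_fun_bij η).

Lemma resKE η k : i (resK η k) = val η (i k).
Proof. exact: res_funE. Qed.

Lemma resK_morph : {morph resK : x y / x * y}.
Proof.
move=> f g; apply: aut_ext => k; apply: (@ext_inj_injective _ _ _ E).
by rewrite autM !resKE.
Qed.

HB.instance Definition _ := isUMagmaMorphism.Build AutK (Aut K) resK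
  (groupHomP resK_morph).

Definition proj_fun (η : AutK) (p : P) : P := π (val η (ext_sect p)).

Lemma proj_funE η n : proj_fun η (π n) = π (val η n).
Proof.
rewrite /proj_fun; have [k kE] := ext_proj_eq (ext_sectK (π n)).
by rewrite [in RHS]kE !gmulfM /= -[val η (i k)]resKE ext_proj_inj mulg1.
Qed.

Lemma proj_fun_morph η : {morph proj_fun η : x y / x * y}.
Proof.
move=> p q; rewrite -{1}(ext_sectK p) -{1}(ext_sectK q) -gmulfM proj_funE.
by rewrite !gmulfM.
Qed.

Lemma proj_fun_bij η : bijective (proj_fun η).
Proof.
exists (proj_fun (η^-1)%g) => p; rewrite -(ext_sectK p) !proj_funE;
  by rewrite /= ?aut_invK ?aut_Kinv.
Qed.

Definition projP (η : AutK) : Aut P := MkAut (proj_fun_morph η) (proj_fun_bij η).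

Lemma projPE η n : projP η (π n) = π (val η n).
Proof. exact: proj_funE. Qed.

Lemma projP_morph : {morph projP : x y / x * y}.
Proof.
move=> f g; apply: aut_ext => p; rewrite -(ext_sectK p).
by rewrite autM !projPE.
Qed.

HB.instance Definition _ := isUMagmaMorphism.Build AutK (Aut P) projP
  (groupHomP projP_morph).

Lemma inner_stabK n : inner n \in stabK.
Proof.
have h m x : range i x -> range i (inner m x).
  rewrite ext_exact /= => xE.
  by rewrite !gmulfM xE mulg1 -gmulfM mulgV gmulf1.
apply/stabKP/seteqP; split=> [x [y yi <-]|x xi]; first exact: h.
exists (inner n^-1 x); first exact: h.
by rewrite /= invgK !mulgA mulgV mul1g mulgK.
Qed.

Definition innerN (n : N) : AutK := exist _ (inner n) (inner_stabK n).

Lemma innerN_morph : {morph innerN : x y / x * y}.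
Proof. by move=> x y; apply: val_inj; rewrite /= -gmulfM. Qed.

HB.instance Definition _ := isUMagmaMorphism.Build N AutK innerN
  (groupHomP innerN_morph).

Definition InnK : {pred AutK} := fun η => `[< exists k, η = innerN (i k) >].

Lemma innKP η : reflect (exists k, η = innerN (i k)) (η \in InnK).
Proof. exact: asboolP. Qed.

Lemma InnK1 : 1 \in InnK.
Proof. by apply/innKP; exists 1; rewrite !gmulf1. Qed.
Lemma InnKM : mulg_closed InnK.
Proof.
move=> f g /innKP[x ->] /innKP[y ->]; apply/innKP; exists (x * y).
by rewrite !gmulfM.
Qed.
Lemma InnKV : invg_closed InnK.
Proof. by move=> f /innKP[x ->]; apply/innKP; exists x^-1; rewrite !gmulfV. Qed.
Lemma InnKJ (g f : AutK) : f \in InnK -> g * f * g^-1 \in InnK.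
Proof.
move=> /innKP[y ->]; apply/innKP; exists (resK g y).
apply: val_inj; rewrite [RHS]/= res_funE.
exact: (aut_inner (val g) (i y)).
Qed.

HB.instance Definition _ := isMulClosed.Build AutK InnK InnKM.
HB.instance Definition _ := isMul1Closed.Build AutK InnK InnK1.
HB.instance Definition _ := isInvClosed.Build AutK InnK InnKV.
HB.instance Definition _ := isConjClosed.Build AutK InnK (fun g f => @InnKJ g f).

Definition OutNK := quot InnK.
HB.instance Definition _ := Group.on OutNK.

(* k |-> n k n^-1 on K; for an extension P -> Q -> R this is the conjugation
   action Q -> Aut(P). *)
Definition conjK : {hom N -> Aut K} := resK \o innerN.

Lemma conjKE n k : i (conjK n k) = n * i k * n^-1.
Proof. by rewrite /conjK /= res_funE. Qed.

Lemma conjK_inj k : conjK (i k) = inner k.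
Proof.
apply: aut_ext => l; apply: (@ext_inj_injective _ _ _ E).
by rewrite conjKE /= !gmulfM gmulfV.
Qed.

Lemma resK_InnK η : η \in InnK -> (@qpi _ (@Inn K) \o resK) η = 1.
Proof.
move=> /innKP[k ->] /=; apply/qpi1P/innP; exists k; exact: conjK_inj.
Qed.

Definition OutNK_to_Out : {hom OutNK -> Out K} := quot_lift resK_InnK.

Lemma OutNK_to_OutE η : OutNK_to_Out (qpi _ η) = qpi _ (resK η).
Proof. exact: (quot_liftE resK_InnK). Qed.

Lemma projP_InnK η : η \in InnK -> projP η = 1.
Proof.
move=> /innKP[k ->]; apply: aut_ext => p; rewrite -(ext_sectK p) projPE /=.
by rewrite !gmulfM gmulfV /= ext_proj_inj mul1g invg1 mulg1.
Qed.

Definition OutNK_to_AutP : {hom OutNK -> Aut P} := quot_lift projP_InnK.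

Lemma OutNK_to_AutPE η : OutNK_to_AutP (qpi _ η) = projP η.
Proof. exact: (quot_liftE projP_InnK). Qed.

Lemma innerN_inj k : (@qpi _ InnK \o innerN) (i k) = 1.
Proof. by apply/qpi1P/innKP; exists k. Qed.

(* modK_outer is Θ_P : P -> Out(N;K), and ext_outer is the outer action
   P -> Out(K); see modK_outerE and ext_outerE. *)
Definition modK_outer : {hom P -> OutNK} := ext_desc innerN_inj.

Lemma modK_outerE n : modK_outer (π n) = qpi _ (innerN n).
Proof. exact: (ext_descE innerN_inj). Qed.

Lemma conjK_trivial k : (@qpi _ (@Inn K) \o conjK) (i k) = 1.
Proof. by apply/qpi1P/innP; exists k; exact: conjK_inj. Qed.

Definition ext_outer : {hom P -> Out K} := ext_desc conjK_trivial.

Lemma ext_outerE n : ext_outer (π n) = qpi _ (conjK n).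
Proof. exact: (ext_descE conjK_trivial). Qed.

Definition AutKNP (η : Aut N) : Prop :=
  (forall k, η (i k) = i k) /\ (forall n, π (η n) = π n).

End Extensions.

(* Z(K) as an H-module through an outer action ρ; out_center is the action of
   Out(K) on Z(K), on which inner automorphisms are trivial. *)
Definition center_mod (H K : groupType) (ρ : {hom H -> Out K}) : gmodule H :=
  GModule (@centerC K) (out_center K \o ρ).

Lemma oactM K (o1 o2 : Out K) z :
  out_center K (o1 * o2) z = out_center K o1 (out_center K o2 z).
Proof. by rewrite gmulfM. Qed.

Lemma oact1 K z : out_center K 1 z = z.
Proof. by rewrite gmulf1. Qed.

Section ActionOnH1.
Variables (K P Q R : groupType) (PQR : extension P Q R) (θ : {hom Q -> Out K}).
Local Notation j := (ext_inj PQR).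
Local Notation φ := (ext_proj PQR).

Definition ZK : gmodule P := center_mod (θ \o j).

Local Notation "q ∙ z" := (out_center K (θ q) z) (at level 39).

Lemma zk_actE p z : gm_act ZK p z = j p ∙ z.
Proof. by []. Qed.

Lemma conjK_actE q p : j (conjK PQR q^-1 p) = q^-1 * j p * q.
Proof. by rewrite conjKE invgK. Qed.

Lemma act_norm q (λ : Z1 ZK) : q ∙ λ (conjK PQR q^-1 1) = 1.
Proof. by rewrite aut_1r z1_norm aut_1r. Qed.

Lemma act_cocycle q (λ : Z1 ZK) p1 p2 :
  q ∙ λ (conjK PQR q^-1 (p1 * p2)) =
  q ∙ λ (conjK PQR q^-1 p1) * gm_act ZK p1 (q ∙ λ (conjK PQR q^-1 p2)).
Proof.
rewrite aut_mulr z1_cocycle aut_mulr; congr (_ * _).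
by rewrite !zk_actE -!oactM -!gmulfM conjK_actE !mulgA mulgV mul1g.
Qed.

(* (q λ)(p) = θ(q) · λ(q^-1 p q), as conjK PQR q^-1 is p |-> q^-1 p q. *)
Definition z1_act q (λ : Z1 ZK) : Z1 ZK :=
  @MkZ1 _ ZK (fun p => q ∙ λ (conjK PQR q^-1 p)) (act_norm q λ) (act_cocycle q λ).

Lemma z1_act_morph q : {morph z1_act q : λ μ / λ * μ}.
Proof. by move=> λ μ; apply: z1_ext => p; exact: aut_mulr. Qed.

HB.instance Definition _ q := isUMagmaMorphism.Build (Z1 ZK) (Z1 ZK) (z1_act q)
  (groupHomP (z1_act_morph q)).

Lemma z1_actM q1 q2 λ : z1_act (q1 * q2) λ = z1_act q1 (z1_act q2 λ).
Proof.
apply: z1_ext => p.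
rewrite -[LHS]/((q1 * q2) ∙ λ (conjK PQR (q1 * q2)^-1 p)) invgM.
by rewrite gmulfM oactM gmulfM.
Qed.

Lemma z1_act1 λ : z1_act 1 λ = λ.
Proof. apply: z1_ext => p; rewrite -[LHS]/(1 ∙ λ (conjK PQR 1^-1 p)).
by rewrite gmulf1 oact1 invg1 gmulf1. Qed.

Lemma z1_act_B1 q λ : λ \in @B1 _ ZK -> (@qpi _ (@B1 _ ZK) \o z1_act q) λ = 1.
Proof.
move=> /b1P[a λE]; apply/qpi1P/b1P; exists (q ∙ a) => p.
rewrite -[LHS]/(q ∙ λ (conjK PQR q^-1 p)) λE aut_mulr aut_invr; congr (_ * _).
by rewrite !zk_actE -!oactM -!gmulfM conjK_actE !mulgA mulgV mul1g.
Qed.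

Definition h1_act_hom q : {hom H1 ZK -> H1 ZK} := quot_lift (@z1_act_B1 q).

Lemma h1_act_homE q λ : h1_act_hom q (qpi _ λ) = qpi _ (z1_act q λ).
Proof. exact: (quot_liftE (@z1_act_B1 q) λ). Qed.

Lemma h1_act_bij q : bijective (h1_act_hom q).
Proof.
exists (h1_act_hom q^-1) => x; have [λ <-] := qpi_surj x;
  by rewrite !h1_act_homE -z1_actM ?mulVg ?mulgV z1_act1.
Qed.

Definition h1_aut q : Aut (H1 ZK) := MkAut (gmulfM (s:=h1_act_hom q)) (h1_act_bij q).

Lemma h1_aut_morph : {morph h1_aut : q1 q2 / q1 * q2}.
Proof.
move=> q1 q2; apply: aut_ext => x; have [λ <-] := qpi_surj x.
rewrite autM -[h1_aut q1 _]/(h1_act_hom q1 (h1_act_hom q2 (qpi _ λ))).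
by rewrite !h1_act_homE -z1_actM -h1_act_homE.
Qed.

HB.instance Definition _ := isUMagmaMorphism.Build Q (Aut (H1 ZK)) h1_aut
  (groupHomP h1_aut_morph).

Lemma h1_aut_trivial p : h1_aut (j p) = 1.
Proof.
apply: aut_ext => x; have [λ <-] := qpi_surj x.
rewrite -[LHS]/(h1_act_hom (j p) (qpi _ λ)) h1_act_homE aut1.
apply/esym/qpi_eqP/b1P; exists (λ p) => p'.
rewrite -[LHS]/((λ p')^-1 * j p ∙ λ (conjK PQR (j p)^-1 p')) -zk_actE.
rewrite -gmulfV conjK_inj.
rewrite -[inner p^-1 p']/(p^-1 * p' * p^-1^-1) invgK -mulgA.
have h : gm_act ZK p (λ p^-1) = (λ p)^-1.
  by apply: (mulgI (λ p)); rewrite -z1_cocycle !mulgV z1_norm.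
have pV a : gm_act ZK p (gm_act ZK p^-1 a) = a.
  by rewrite -actM mulgV act1.
rewrite !z1_cocycle !aut_mulr h !pV.
by rewrite mulgA [(λ p')^-1 * _]gm_comm -mulgA mulKg.
Qed.

(* P acts trivially on H^1(P, Z(K)) by h1_aut_trivial, so the action of Q
   descends to R: see h1_modE. *)
Definition h1_mod : gmodule R :=
  GModule (@h1C _ ZK) (ext_desc h1_aut_trivial).

Lemma h1_modE q λ :
  gm_act h1_mod (φ q) (qpi _ λ) = qpi _ (z1_act q λ).
Proof.
rewrite -[gm_act h1_mod _]/(ext_desc h1_aut_trivial (φ q)) ext_descE.
exact: h1_act_homE.
Qed.

End ActionOnH1.

Section Embedding.
Variables (K N P : groupType) (E : extension K N P) (ρ : {hom P -> Out K}).
Local Notation i := (ext_inj E).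
Local Notation π := (ext_proj E).
Local Notation A := (center_mod ρ).
Hypothesis outerE : ext_outer E =1 ρ.

Lemma center_actE n (z : center K) :
  i (val (out_center K (ρ (π n)) z)) = n * i (val z) * n^-1.
Proof.
have -> : ρ (π n) = qpi _ (conjK E n).
  by rewrite -outerE; exact: (ext_descE (conjK_trivial E) n).
have -> : out_center K (qpi _ (conjK E n)) = aut_center (conjK E n).
  exact: (quot_liftE (@aut_center_Inn K)).
exact: conjKE.
Qed.

(* outerE makes twist λ an automorphism: the module structure of Z(K) must be
   the one given by conjugation in N. *)
Definition twist (λ : Z1 A) (n : N) : N := i (val (λ (π n))) * n.

Lemma twist_morph λ : {morph twist λ : m n / m * n}.
Proof.
move=> m n; rewrite /twist gmulfM z1_cocycle /= gmulfM center_actE.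
by rewrite !mulgA mulgVK.
Qed.

Lemma twist_projE λ n : π (twist λ n) = π n.
Proof. by rewrite gmulfM /= ext_proj_inj mul1g. Qed.

Lemma twistM λ μ n : twist (λ * μ) n = twist λ (twist μ n).
Proof. by rewrite {2}/twist twist_projE /twist /= gmulfM mulgA. Qed.

Lemma twist1 n : twist 1 n = n.
Proof. by rewrite /twist /= gmulf1 mul1g. Qed.

Lemma twist_bij λ : bijective (twist λ).
Proof.
by exists (twist λ^-1) => n; rewrite -twistM ?mulVg ?mulgV twist1.
Qed.

Definition twist_aut (λ : Z1 A) : Aut N := MkAut (twist_morph λ) (twist_bij λ).

Lemma twist_injE λ k : twist λ (i k) = i k.
Proof. by rewrite /twist ext_proj_inj z1_norm /= gmulf1 mul1g. Qed.

Lemma AutKNP_stabK (η : Aut N) : AutKNP E η -> η \in stabK E.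
Proof.
case=> ηi _; apply/stabKP/seteqP.
split=> [n [m [k _ <-] <-]|n [k _ <-]]; first by exists k.
by exists (i k) => //; exists k.
Qed.

Lemma twist_AutKNP λ : AutKNP E (twist_aut λ).
Proof. by split=> [k|n]; rewrite /= ?twist_injE ?twist_projE. Qed.

Definition twist_AutK (λ : Z1 A) : AutK E :=
  exist _ (twist_aut λ) (AutKNP_stabK (twist_AutKNP λ)).

Lemma twist_AutK_morph : {morph twist_AutK : λ μ / λ * μ}.
Proof.
by move=> λ μ; apply: val_inj; apply: aut_ext => n /=; rewrite twistM.
Qed.

HB.instance Definition _ := isUMagmaMorphism.Build (Z1 A) (AutK E) twist_AutK
  (groupHomP twist_AutK_morph).

Lemma twist_B1 λ : λ \in @B1 _ A -> (@qpi _ (@InnK _ _ _ E) \o twist_AutK) λ = 1.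
Proof.
move=> /b1P[a λE]; apply/qpi1P/innKP; exists (val a)^-1.
apply: val_inj; apply: aut_ext => n /=; rewrite /twist λE gmulfM center_actE.
rewrite -!mulgA mulVg mulg1; congr (_ * (_ * _)).
by rewrite gmulfV invgK.
Qed.

(* The identification of H^1(P, Z(K)) with Out(KNP;K) inside Out(N;K). *)
Definition h1_embed : {hom H1 A -> OutNK E} := quot_lift twist_B1.

Lemma h1_embedE λ : h1_embed (qpi _ λ) = qpi _ (twist_AutK λ).
Proof. exact: quot_liftE. Qed.

End Embedding.

Section Prolongations.
Variables (K P Q R : groupType) (PQR : extension P Q R) (θ : {hom Q -> Out K}).
Variables (N : groupType) (KNP : extension K N P).

Record is_prolongation (Θ : Q -> OutNK KNP) : Prop := IsProlongation {
  prol_morph : {morph Θ : x y / x * y};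
  prol_extends : forall p, Θ (ext_inj PQR p) = modK_outer KNP p;
  prol_outer : forall q, OutNK_to_Out KNP (Θ q) = θ q;
  prol_conj : forall q, OutNK_to_AutP KNP (Θ q) = conjK PQR q }.

Definition prolongations : set (Q -> OutNK KNP) := [set Θ | is_prolongation Θ].

Definition AutKNP_conj (Θ1 Θ2 : Q -> OutNK KNP) : Prop :=
  exists2 η : AutK KNP, AutKNP KNP (val η) &
    forall q, Θ2 q = (qpi _ η)^-1 * Θ1 q * qpi _ η.

Definition conj_class (Θ : Q -> OutNK KNP) : set (Q -> OutNK KNP) :=
  [set Θ' | is_prolongation Θ' /\ AutKNP_conj Θ Θ'].

Definition conj_classes : set (set (Q -> OutNK KNP)) :=
  conj_class @` prolongations.

(* The product Γ(φ(q)) · Θ(q), with Γ(φ(q)) read in Out(N;K). *)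
Definition diamond (outerE : ext_outer KNP =1 θ \o ext_inj PQR)
    (Θ : Q -> OutNK KNP) (Γ : Z1 (h1_mod PQR θ)) : Q -> OutNK KNP :=
  fun q => h1_embed outerE (Γ (ext_proj PQR q)) * Θ q.

End Prolongations.

Arguments prolongations {K P Q R} PQR θ {N} KNP.
Arguments conj_classes {K P Q R} PQR θ {N} KNP.

(* Main.v *)
Require Import Defs.
From mathcomp Require Import all_boot.
From mathcomp Require Import boolp classical_sets functions.

(** Write ι for [h1_embed], the embedding of H^1(P, Z(K)) into Out(N;K), and
    call the two canonical homomorphisms from Out(N;K) to Out(K) and to Aut(P)
    its shadows.  Everything follows from two facts about ι.

    - ι is injective, and its image is exactly the set of classes with both
      shadows trivial ([h1_embed_inj], [h1_embed_surj]).  An automorphism η of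
      N which is the identity on K and over P moves every n by the factor
      η(n) n^-1, which is a central element of K depending only on the image
      of n in P: this factor is the cocycle.
    - A class c whose shadows are θ(q) and conjugation by q satisfies
      c ι(x) c^-1 = ι(q x) ([h1_embed_equivariant]).

    Two prolongations have the same shadows at every q, so their quotient
    takes values in the image of ι; the quotient is trivial on P, hence is a
    function of φ(q).  By equivariance the cocycle identity of Γ is equivalent
    to multiplicativity of q |-> ι(Γ(φ(q))) Θ(q), which gives the bijection on
    cocycles.  Also by equivariance, replacing a prolongation Θ' by
    ι(a)^-1 Θ' ι(a) multiplies Γ by the coboundary r |-> a^-1 (r a); since
    Out(KNP;K) is the image of ι, the conjugacy class of a prolongation is the
    image of a coset of B^1 ([diamond_conjP]), and the bijection descends to H^1. *)

Set Implicit Arguments.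
Unset Strict Implicit.
Unset Printing Implicit Defensive.

Local Open Scope classical_set_scope.
Local Open Scope group_scope.

(** * The embedding of H^1(P, Z(K)) in Out(N;K) *)

Section Embedding.
Variables (K N P : groupType) (E : extension K N P) (ρ : {hom P -> Out K}).
Hypothesis outerE : ext_outer E =1 ρ.
Local Notation i := (ext_inj E).
Local Notation π := (ext_proj E).
Local Notation A := (center_mod ρ).

(** If the twist by λ is conjugation by k, evaluating it on K shows that k is
    central, and evaluating it on N shows that λ is the coboundary of k^-1. *)
Lemma h1_embed_inj : injective (h1_embed outerE).
Proof.
suff ker x : h1_embed outerE x = 1 -> x = 1.
  move=> x y xy; apply: (mulIg y^-1); rewrite mulgV; apply: ker.
  by rewrite gmulfM gmulfV xy mulgV.
have [λ <-] := qpi_surj x; rewrite h1_embedE => /qpi1P/innKP[k kE].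
have twistE n : i (val (λ (π n))) * n = i k * n * (i k)^-1.
  by rewrite -[LHS]/(val (twist_AutK outerE λ) n) kE.
have kz : k \in @ctr K.
  apply/ctrP => l; apply: (@ext_inj_injective _ _ _ E).
  have := twistE (i l).
  rewrite ext_proj_inj z1_norm /= gmulf1 mul1g => lE.
  by rewrite !gmulfM {2}lE mulgVK.
pose z : center K := exist _ k kz.
apply/qpi1P/b1P; exists z^-1 => p; rewrite -(ext_sectK E p).
set n := ext_sect E p; apply: val_inj; apply: (@ext_inj_injective _ _ _ E).
apply: (mulIg n); rewrite twistE !gmulfM /=.
rewrite -[X in _ * i X * n]/(val (out_center K (ρ (π n)) z^-1)) (center_actE outerE) /=.
by rewrite invgK gmulfV !mulgA mulgVK.
Qed.

Section Displacement.
Variables (η : AutK E) (ηKNP : AutKNP E (val η)).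

(** The element k below is η(n) n^-1.  Conjugation by n permutes K, and η is
    the identity on K, so n and η(n) conjugate K in the same way: k is
    central. *)
Lemma displacement_ex (p : P) :
  exists z : center K, forall n, π n = p -> val η n = i (val z) * n.
Proof.
have [ηi ηπ] := ηKNP; pose m := ext_sect E p.
have /ext_kerP[k kE] : π (val η m * m^-1) = 1.
  by rewrite gmulfM ηπ gmulfV mulgV.
have ηm : val η m = i k * m by rewrite kE mulgVK.
have kz : k \in @ctr K.
  apply/ctrP => l; apply: (@ext_inj_injective _ _ _ E).
  have := ηi (conjK E m^-1 l).
  rewrite conjKE invgK !aut_mulr aut_invr ηi ηm invgM !mulgA => /mulIg.
  by rewrite -!mulgA => /mulgI lE; rewrite !gmulfM -{1}lE mulVKg.
exists (exist _ k kz) => n nE.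
have [l ->] := ext_proj_eq (etrans (ext_sectK E p) (esym nE)).
by rewrite aut_mulr ηi ηm mulgA.
Qed.

Lemma AutKNP_twist : exists λ : Z1 A, η = twist_AutK outerE λ.
Proof.
pose f p := sval (cid (displacement_ex p)).
have fE n : val η n = i (val (f (π n))) * n.
  by rewrite /f; case: cid => z /=; apply.
have iz : injective (fun z : center K => i (val z)).
  by move=> z w /(@ext_inj_injective _ _ _ E)/val_inj.
have f1 : f 1 = 1.
  apply: iz; apply: (mulIg 1).
  by have := fE 1; rewrite aut_1r gmulf1 => <-; rewrite /= gmulf1 mulg1.
have fM p q : f (p * q) = f p * gm_act A p (f q).
  rewrite -(ext_sectK E p) -(ext_sectK E q).
  set m := ext_sect E p; set n := ext_sect E q.
  apply: iz; apply: (mulIg (m * n)); rewrite -gmulfM -fE aut_mulr !fE.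
  rewrite /= gmulfM (center_actE outerE) !mulgA.
  by rewrite mulgVK.
exists (@MkZ1 _ A f f1 fM); apply: val_inj; apply: aut_ext => n.
exact: fE.
Qed.

End Displacement.

(** Triviality in Out(K) says that a representative η acts on K as conjugation
    by some k in K.  Removing that conjugation does not change the class, nor
    the action on P, and leaves an element of Aut(KNP), hence a twist. *)
Lemma h1_embed_surj (c : OutNK E) :
  OutNK_to_Out E c = 1 -> OutNK_to_AutP E c = 1 ->
  exists x, h1_embed outerE x = c.
Proof.
have [η <-] := qpi_surj c.
rewrite OutNK_to_OutE OutNK_to_AutPE => /qpi1P/innP[k kE] ηP.
pose η' := innerN E (i k)^-1 * η.
have η'KNP : AutKNP E (val η').
  split=> [l|n].
    rewrite -[LHS]/((i k)^-1 * val η (i l) * (i k)^-1^-1) -resKE kE /=.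
    by rewrite !gmulfM gmulfV invgK !mulgA mulVg mul1g mulgVK.
  rewrite -[val η' n]/((i k)^-1 * val η n * (i k)^-1^-1) !gmulfM !gmulfV.
  by rewrite /= ext_proj_inj !invg1 mul1g mulg1 -projPE ηP.
have [λ λE] := AutKNP_twist η'KNP.
exists (qpi _ λ); rewrite h1_embedE -λE.
rewrite gmulfM -[RHS]mul1g; congr (_ * _).
by apply/qpi1P/innKP; exists k^-1; rewrite gmulfV.
Qed.

Lemma h1_embed_Out x : OutNK_to_Out E (h1_embed outerE x) = 1.
Proof.
have [λ <-] := qpi_surj x; rewrite h1_embedE OutNK_to_OutE.
have -> : resK (twist_AutK outerE λ) = 1; last by rewrite gmulf1.
apply: aut_ext => k; apply: (@ext_inj_injective _ _ _ E).
by rewrite resKE /= twist_injE.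
Qed.

Lemma h1_embed_AutP x : OutNK_to_AutP E (h1_embed outerE x) = 1.
Proof.
have [λ <-] := qpi_surj x; rewrite h1_embedE OutNK_to_AutPE.
apply: aut_ext => p; rewrite -(ext_sectK E p) projPE.
exact: twist_projE.
Qed.

End Embedding.

(** * Prolongations as a torsor under cocycles *)

Section Prolongations.
Variables (K P Q R : groupType) (PQR : extension P Q R).
Variables (θ : {hom Q -> Out K}) (N : groupType) (KNP : extension K N P).
Hypothesis outerE : ext_outer KNP =1 θ \o ext_inj PQR.
Local Notation j := (ext_inj PQR).
Local Notation φ := (ext_proj PQR).
Local Notation A := (h1_mod PQR θ).
Local Notation ι := (h1_embed outerE).

(** On representatives, η (twist λ) η^-1 multiplies n by η applied to the
    value of λ at the image of η^-1(n); this is the twist by the translate of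
    λ, since η acts on Z(K) through θ(q) and on P by conjugation by q. *)
Lemma h1_embed_equivariant (c : OutNK KNP) q (x : A) :
  OutNK_to_Out KNP c = θ q -> OutNK_to_AutP KNP c = conjK PQR q ->
  c * ι x = ι (gm_act A (φ q) x) * c.
Proof.
have [η <-] := qpi_surj c; have [λ <-] := qpi_surj x.
rewrite OutNK_to_OutE OutNK_to_AutPE => ηθ ηP.
rewrite h1_modE !h1_embedE -!gmulfM; congr qpi.
apply: val_inj; apply: aut_ext => n.
rewrite -[LHS]/(val η (ext_inj KNP (val (λ (ext_proj KNP n))) * n)).
rewrite gmulfM /=.
rewrite /twist -projPE ηP; congr (_ * _).
set p := ext_proj KNP n.
rewrite -[X in _ = ext_inj _ (val X)]/(out_center K (θ q)
  (λ (conjK PQR q^-1 (conjK PQR q p)))).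
rewrite -autM -gmulfM mulVg gmulf1 aut1 -ηθ.
rewrite [out_center K _](quot_liftE (@aut_center_Inn K)).
by rewrite [RHS]resKE.
Qed.

Variables (Θ : Q -> OutNK KNP) (prolΘ : is_prolongation PQR θ Θ).

Lemma prol_equivariant q (x : A) : Θ q * ι x = ι (gm_act A (φ q) x) * Θ q.
Proof.
by apply: h1_embed_equivariant; [apply: (prol_outer prolΘ)|apply: (prol_conj prolΘ)].
Qed.

Lemma diamond_prolongation Γ : is_prolongation PQR θ (diamond outerE Θ Γ).
Proof.
split=> [q1 q2|p|q|q]; rewrite /diamond.
- rewrite gmulfM z1_cocycle gmulfM (prol_morph prolΘ) -!mulgA; congr (_ * _).
  by rewrite !mulgA prol_equivariant.
- by rewrite ext_proj_inj z1_norm gmulf1 mul1g (prol_extends prolΘ).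
- by rewrite gmulfM h1_embed_Out mul1g (prol_outer prolΘ).
- by rewrite gmulfM h1_embed_AutP mul1g (prol_conj prolΘ).
Qed.

Lemma diamond_inj : injective (diamond outerE Θ).
Proof.
move=> Γ1 Γ2 Γ12; apply: z1_ext => r; rewrite -(ext_sectK PQR r).
apply: (@h1_embed_inj _ _ _ _ _ outerE).
have /(congr1 (fun f => f (ext_sect PQR r))) := Γ12.
exact: mulIg.
Qed.

Lemma diamond_surj Θ' : is_prolongation PQR θ Θ' ->
  exists Γ, diamond outerE Θ Γ = Θ'.
Proof.
move=> prolΘ'.
have γ_ex q : exists x, ι x = Θ' q * (Θ q)^-1.
  apply: h1_embed_surj; rewrite gmulfM gmulfV.
    by rewrite (prol_outer prolΘ) (prol_outer prolΘ') mulgV.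
  by rewrite (prol_conj prolΘ) (prol_conj prolΘ') mulgV.
pose f r := sval (cid (γ_ex (ext_sect PQR r))).
have fE q : ι (f (φ q)) * Θ q = Θ' q.
  (* Both prolongations restrict to Θ_P on P, so their quotient at q is
     unchanged when q is multiplied by an element of P on the right. *)
  rewrite /f; case: cid => x /= ->.
  have [p pE] := ext_proj_eq (ext_sectK PQR (φ q)).
  rewrite [in RHS]pE [in X in _ * X]pE (prol_morph prolΘ) (prol_morph prolΘ').
  by rewrite (prol_extends prolΘ) (prol_extends prolΘ') mulgA mulgVK.
have f1 : f 1 = 1.
  apply: (@h1_embed_inj _ _ _ _ _ outerE); apply: (mulIg (Θ (j 1))).
  have := fE (j 1); rewrite ext_proj_inj => ->.
  by rewrite [ι 1]gmulf1 mul1g (prol_extends prolΘ) (prol_extends prolΘ').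
have fM r s : f (r * s) = f r * gm_act A r (f s).
  rewrite -(ext_sectK PQR r) -(ext_sectK PQR s).
  set p := ext_sect PQR r; set q := ext_sect PQR s.
  apply: (@h1_embed_inj _ _ _ _ _ outerE); apply: (mulIg (Θ (p * q))).
  rewrite -gmulfM fE (prol_morph prolΘ') -!fE (prol_morph prolΘ) gmulfM.
  by rewrite -!mulgA; congr (_ * _); rewrite !mulgA prol_equivariant.
exists (@MkZ1 _ A f f1 fM); apply: funext => q; exact: fE.
Qed.

(** Elements of Aut(KNP) are twists, so conjugation by them is conjugation by
    some ι(a); moving ι(a) across Θ(q) turns it into ι(φ(q) a). *)
Lemma diamond_conjP Γ1 Γ2 :
  AutKNP_conj (diamond outerE Θ Γ1) (diamond outerE Θ Γ2) <->
  qpi (@B1 _ A) Γ1 = qpi _ Γ2.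
Proof.
have conjE a q : (ι a)^-1 * diamond outerE Θ Γ1 q * ι a =
    ι (Γ1 (φ q) * (a^-1 * gm_act A (φ q) a)) * Θ q.
  rewrite /diamond -!mulgA prol_equivariant.
  rewrite !mulgA -gmulfV -!gmulfM; congr (ι (_ * _) * _).
  exact: h1C.
rewrite qpi_eqP; split=> [[η /(AutKNP_twist outerE)[λ ->] ηE]|/b1P[a aE]].
  apply/b1P; exists (qpi _ λ) => r; rewrite -(ext_sectK PQR r).
  set q := ext_sect PQR r; apply: (mulgI (Γ1 (φ q))).
  apply: (@h1_embed_inj _ _ _ _ _ outerE); apply: (mulIg (Θ q)).
  by rewrite /= mulVKg -conjE h1_embedE; apply: ηE.
have [λ λE] := qpi_surj a.
exists (twist_AutK outerE λ) => [|q]; first exact: twist_AutKNP.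
transitivity (ι (Γ1 (φ q) * (a^-1 * gm_act A (φ q) a)) * Θ q).
  by rewrite -aE /= mulVKg.
by rewrite -conjE -λE h1_embedE.
Qed.

(** The classes are the images of the fibres of Z^1 -> H^1, so the induced map
    can be defined as the image of a fibre; its injectivity is then that of the
    map on cocycles. *)
Lemma conj_class_diamond Γ :
  conj_class PQR θ (diamond outerE Θ Γ) =
  diamond outerE Θ @` [set Γ' | qpi (@B1 _ A) Γ' = qpi _ Γ].
Proof.
apply/seteqP; split=> [Θ' [/diamond_surj[Γ' <-] /diamond_conjP ΓΓ']|].
  by exists Γ'.
move=> _ [Γ' /esym ΓΓ' <-]; split; first exact: diamond_prolongation.
exact/diamond_conjP.
Qed.

End Prolongations.

Theorem corollary15p5 (K P Q R : groupType) (PQR : extension P Q R)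
    (θ : {hom Q -> Out K}) (N : groupType) (KNP : extension K N P)
    (outerE : ext_outer KNP =1 θ \o ext_inj PQR)
    (Θ : Q -> OutNK KNP) (prolΘ : is_prolongation PQR θ Θ) :
  set_bij [set: Z1 (h1_mod PQR θ)] (prolongations PQR θ KNP)
    (diamond outerE Θ) /\
  exists D : H1 (h1_mod PQR θ) -> set (Q -> OutNK KNP),
    (forall Γ : Z1 (h1_mod PQR θ),
       D (qpi _ Γ) = conj_class PQR θ (diamond outerE Θ Γ)) /\
    set_bij [set: H1 (h1_mod PQR θ)] (conj_classes PQR θ KNP) D.
Proof.
split.
  split=> [Γ _|Γ1 Γ2 _ _|Θ' prolΘ'].
  - exact: diamond_prolongation.
  - exact: diamond_inj.
  - by have [Γ <-] := diamond_surj outerE prolΘ prolΘ'; exists Γ.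
exists (fun c => diamond outerE Θ @` [set Γ | qpi _ Γ = c]).
split=> [Γ|]; first by rewrite conj_class_diamond.
split=> [c _|c1 c2 _ _ c12|_ [Θ' prolΘ' <-]].
- have [Γ <-] := qpi_surj c; exists (diamond outerE Θ Γ).
    exact: diamond_prolongation.
  by rewrite conj_class_diamond.
- have [Γ1 Γ1E] := qpi_surj c1.
  have : (diamond outerE Θ @` [set Γ | qpi _ Γ = c1]) (diamond outerE Θ Γ1).
    by exists Γ1.
  by rewrite c12 => -[Γ2 /= <- /diamond_inj ->].
- have [Γ <-] := diamond_surj outerE prolΘ prolΘ'.
  by exists (qpi _ Γ); rewrite ?conj_class_diamond.
Qed.
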